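(* The set $\mathfrak{X}_{\mathfrak{u}(2)}$ of all complex structures on $\mathfrak{u}(2)$, viewed as a subset of $\mathbb{R}^{16}$ (real $4\times4$ matrices), is a closed 4-dimensional smooth submanifold of $\mathbb{R}^{16}$ with 2 connected components, each of them diffeomorphic to $\mathbb{R}\times(\mathbb{R}^3\setminus\{0\})$.
   Context: $\mathfrak{u}(2)=\mathfrak{su}(2)\oplus\mathbb{R}J_4$ is the real Lie algebra with basis $(J_1,J_2,J_3,J_4)$, where $[J_1,J_2]=J_3$, $[J_2,J_3]=J_1$, $[J_3,J_1]=J_2$ and $J_4$ is central. Linear maps $\mathfrak{u}(2)\to\mathfrak{u}(2)$ are identified with their $4\times4$ matrices in this basis. A complex structure on a real Lie algebra $\mathfrak{g}$ is a linear map $J:\mathfrak{g}\to\mathfrak{g}$ with $J^2=-1$ and $[JX,JY]-[X,Y]-J[JX,Y]-J[X,JY]=0$ for all $X,Y\in\mathfrak{g}$. *)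

(* Defs.v *)
From HB Require Import structures.
From mathcomp Require Import all_boot all_order all_algebra.
From mathcomp Require Import ring.
From mathcomp Require Import all_classical all_reals all_analysis.
Import Order.TTheory GRing.Theory Num.Theory numFieldNormedType.Exports.

Set Implicit Arguments.
Unset Strict Implicit.
Unset Printing Implicit Defensive.

Local Open Scope classical_set_scope.
Local Open Scope ring_scope.

Section Smooth.
Context {R : realType}.
Implicit Types V W : normedModType R.

(* [Ck_on k U f] is only meant for [U] open. In finite dimension, asking all
   directional derivatives to be C^k amounts to asking the differential to be
   C^k. *)
Fixpoint Ck_on V W (k : nat) (U : set V) (f : V -> W) : Prop :=
  match k with
  | 0%N => forall x, U x -> {for x, continuous f}
  | k'.+1 => (forall x, U x -> differentiable f x) /\
             (forall v : V, Ck_on k' U ('D_v f))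
  end.

(* A map on an arbitrary subset [A] is smooth if near each point of [A] it
   extends to a C^oo map on an open set of the ambient space. For [A] open this
   is the usual notion; for [A] an embedded submanifold it agrees with
   smoothness for the induced manifold structure. *)
Definition smooth_on V W (A : set V) (f : V -> W) : Prop :=
  forall x, A x -> exists (U : set V) (F : V -> W),
    [/\ open U, U x, forall k, Ck_on k U F & {in A `&` U, f =1 F}].

Definition diffeo_between V W (A : set V) (B : set W) (f : V -> W) (g : W -> V)
    : Prop :=
  [/\ smooth_on A f, smooth_on B g,
      {homo f : x / A x >-> B x}, {homo g : y / B y >-> A y} &
      {in A, cancel f g} /\ {in B, cancel g f}].

Definition diffeomorphic V W (A : set V) (B : set W) : Prop :=
  exists f g, diffeo_between A B f g.

Definition coord_slice (n k : nat) : set 'rV[R]_n :=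
  [set y | forall i : 'I_n, (k <= i)%N -> y ord0 i = 0].

(* [M] is a k-dimensional embedded C^oo submanifold of the space of m x n
   matrices, identified with R^(m n): slice charts around each point of [M]. *)
Definition smooth_submanifold (m n k : nat) (M : set 'M[R]_(m, n)) : Prop :=
  (k <= m * n)%N /\
  forall p, M p ->
    exists (U : set 'M[R]_(m, n)) (W : set 'rV[R]_(m * n)) phi psi,
      [/\ open U, U p, open W, diffeo_between U W phi psi &
          phi @` (U `&` M) = W `&` @coord_slice (m * n) k].

End Smooth.

Section ComplexStructure.
Context {R : realType}.

Definition is_complex_structure (g : lmodType R) (br : g -> g -> g)
    (J : {linear g -> g}) : Prop :=
  (forall X, J (J X) = - X) /\
  (forall X Y, br (J X) (J Y) - br X Y - J (br (J X) Y) - J (br X (J Y)) = 0).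

Definition u2_basis (i : 'I_4) : 'cV[R]_4 := delta_mx i ord0.

Notation J1 := (u2_basis (inord 0%N)).
Notation J2 := (u2_basis (inord 1%N)).
Notation J3 := (u2_basis (inord 2%N)).
Notation J4 := (u2_basis (inord 3%N)).

Definition u2_bracket (X Y : 'cV[R]_4) : 'cV[R]_4 :=
  let x (k : nat) := X (inord k) ord0 in
  let y (k : nat) := Y (inord k) ord0 in
  (x 0%N * y 1%N - x 1%N * y 0%N) *: J3
  + (x 1%N * y 2%N - x 2%N * y 1%N) *: J1
  + (x 2%N * y 0%N - x 0%N * y 2%N) *: J2.

Lemma u2_basisE i j : (i < 4)%N -> (j < 4)%N ->
  u2_basis (inord i) (inord j) ord0 = (i == j)%:R.
Proof.
by move=> i4 j4; rewrite mxE eqxx andbT -val_eqE /= !inordK// eq_sym.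
Qed.

Lemma u2_bracket_basis :
  [/\ u2_bracket J1 J2 = J3, u2_bracket J2 J3 = J1, u2_bracket J3 J1 = J2 &
      forall X, u2_bracket X J4 = 0].
Proof.
split=> *; rewrite /u2_bracket !u2_basisE//= ?mulr0n ?mulr1n
  ?(mulr0, mul0r, mulr1, mul1r, subrr, subr0, sub0r).
all: by rewrite ?(oppr0, scale1r, scale0r, addr0, add0r).
Qed.

Lemma u2_bracketxx X : u2_bracket X X = 0.
Proof.
by apply/matrixP => i j; rewrite !mxE; ring.
Qed.

Lemma u2_bracket_linearl a X Y Z :
  u2_bracket (a *: X + Y) Z = a *: u2_bracket X Z + u2_bracket Y Z.
Proof. by apply/matrixP => i j; rewrite !mxE; ring. Qed.

Lemma u2_bracketC X Y : u2_bracket X Y = - u2_bracket Y X.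
Proof. by apply/matrixP => i j; rewrite !mxE; ring. Qed.

Lemma u2_bracket_jacobi X Y Z :
  u2_bracket X (u2_bracket Y Z) + u2_bracket Y (u2_bracket Z X)
  + u2_bracket Z (u2_bracket X Y) = 0.
Proof.
apply/matrixP => i j; rewrite !mxE -!val_eqE /= !inordK//=.
by rewrite ?(mulr0n, mulr1n); ring.
Qed.

(* Matrices act on coordinate columns: the j-th column of [M] holds the
   coordinates of the image of the j-th basis vector. *)
Definition u2_complex_structures : set 'M[R]_4 :=
  [set M | is_complex_structure u2_bracket (mulmx M)].

End ComplexStructure.

(* Main.v *)
(* Write a linear map of R^3 + R J4 as J = (A, b; l, c) in blocks, and let K be
   the cross product by b. Since J4 is central, the Nijenhuis condition on (X, J4)
   says that A commutes with K and that l is proportional to b. Together with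
   J^2 = -1 this forces b <> 0 and, with n = b / |b|,
     A = - c n n^T + e [n]x,   l = - (1 + c^2) b^T / |b|^2,   e = 1 or e = -1.
   Conversely all these J are complex structures. So a complex structure is
   determined by the sign e and its last column (b, c), and the complex
   structures form two smooth graphs over {b <> 0}, straightened by a shear of
   R^16. They are separated by the sign of the polynomial
   b . (antisymmetric part of A), equal to 2 e |b| on the graphs. *)

Require Import Defs.
From HB Require Import structures.
From mathcomp Require Import all_boot all_order all_algebra.
From mathcomp Require Import all_classical all_reals all_analysis.
From mathcomp Require Import ring lra zify.
Import Order.TTheory GRing.Theory Num.Theory numFieldNormedType.Exports.

Local Open Scope classical_set_scope.
Local Open Scope ring_scope.

(** * Calculus of [Ck_on] *)

Section Smoothness.
Context {R : realType}.
Implicit Types V W : normedModType R.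

Lemma near_eq_differentiable V W (f g : V -> W) (x : V) :
  {near x, f =1 g} -> differentiable f x -> differentiable g x.
Proof.
move=> fg /diff_locallyP[dfc dfE].
have fgx : f x = g x by exact: nbhs_singleton fg.
have dgE : g \o shift x = cst (g x) + 'd f x +o_ 0 id.
  apply/eqaddoP => e e0; move/eqaddoP : dfE => /(_ e e0) dfE.
  have fg0 : \forall h \near (0 : V), f (h + x) = g (h + x).
    by move: fg; rewrite (near_shift 0 x) subr0.
  apply: filterS2 fg0 dfE => h Eh.
  by rewrite !fctE /= Eh fgx.
have dgd : 'd g x = 'd f x :> (V -> W) by apply: diff_unique.
by apply/diff_locallyP; rewrite dgd.
Qed.

Lemma open_near_eq V W (U : set V) (f g : V -> W) x :
  open U -> {in U, f =1 g} -> U x -> {near x, f =1 g}.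
Proof.
move=> oU fg Ux; have : nbhs x U by exact: open_nbhs_nbhs.
by apply: filterS => y Uy; exact/fg/mem_set.
Qed.

(** ['D_v f] is a function on the whole space, but the formulas for it hold only on [U]. As [U] is
    open, agreement on [U] is agreement near each of its points, hence passes to derivatives; every
    induction below relies on this. *)
Lemma Ck_on_eq V W k (U : set V) (f g : V -> W) : open U ->
  {in U, f =1 g} -> Ck_on k U f -> Ck_on k U g.
Proof.
move=> oU; elim: k f g => [|k IHk] f g fg.
  move=> fc x Ux; have nfg := open_near_eq _ _ _ _ _ _ oU fg Ux.
  rewrite /prop_for /continuous_at -(nbhs_singleton nfg).
  by apply: cvg_trans (fc x Ux); exact: near_eq_cvg.
case=> fd fk; split.
  by move=> x Ux; apply: near_eq_differentiable (fd x Ux); exact: open_near_eq Ux.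
move=> v; apply: IHk (fk v) => x /set_mem Ux; apply: near_eq_derive.
exact: open_near_eq Ux.
Qed.

Lemma Ck_on_continuous V W k (U : set V) (f : V -> W) x :
  Ck_on k U f -> U x -> {for x, continuous f}.
Proof.
case: k => [fc|k [fd _]] Ux; first exact: fc.
exact/differentiable_continuous/fd.
Qed.

Lemma Ck_onW V W k (U : set V) (f : V -> W) : Ck_on k.+1 U f -> Ck_on k U f.
Proof.
elim: k f => [|k IHk] f; first by move=> fC x; exact: Ck_on_continuous fC.
by case=> fd fk; split=> // v; exact/IHk/fk.
Qed.

Lemma Ck_on_cst V W k (U : set V) (a : W) : Ck_on k U (cst a).
Proof.
elim: k a => [|k IHk] a; first by move=> x _; exact: cst_continuous.
split=> [x _|v]; first exact: differentiable_cst.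
by rewrite (_ : 'D_v (cst a) = cst 0) //; apply/funext => x; exact: derive_cst.
Qed.

Lemma Ck_on_linear V W k (U : set V) (f : {linear V -> W}) :
  continuous f -> Ck_on k U f.
Proof.
move=> fc; case: k => [|k]; first by move=> x _; exact: fc.
split=> [x _|v]; first exact: linear_differentiable.
rewrite (_ : 'D_v f = cst (f v)); first exact: Ck_on_cst.
by apply/funext => x; rewrite deriveE ?diff_lin//; exact: linear_differentiable.
Qed.

Lemma Ck_onD V W k (U : set V) (f g : V -> W) : open U ->
  Ck_on k U f -> Ck_on k U g -> Ck_on k U (fun x => f x + g x).
Proof.
rewrite -[fun x => _]/(f + g) => oU; elim: k f g => [|k IHk] f g.
  by move=> fc gc x Ux; apply: continuousD; [exact: fc|exact: gc].
case=> fd fk [gd gk]; split.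
  by move=> x Ux; apply: differentiableD; [exact: fd|exact: gd].
move=> v; apply: Ck_on_eq (IHk _ _ (fk v) (gk v)) => // x /set_mem Ux.
by rewrite deriveD//; apply: diff_derivable; [exact: fd|exact: gd].
Qed.

Lemma Ck_on_sum V W k (U : set V) I (r : seq I) (P : pred I) (f : I -> V -> W) :
  open U -> (forall i, P i -> Ck_on k U (f i)) ->
  Ck_on k U (fun x => \sum_(i <- r | P i) f i x).
Proof.
move=> oU fk; rewrite -fct_sumE; elim/big_ind: _ => //; first exact: Ck_on_cst.
by move=> g h gC hC; exact: Ck_onD.
Qed.

Lemma Ck_onM V k (U : set V) (f g : V -> R) : open U ->
  Ck_on k U f -> Ck_on k U g -> Ck_on k U (fun x => f x * g x).
Proof.
rewrite -[fun x => _]/(f * g) => oU; elim: k f g => [|k IHk] f g.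
  by move=> fc gc x Ux; apply: continuousM; [exact: fc|exact: gc].
move=> fC gC; have [[fd fk] [gd gk]] := (fC, gC); split.
  by move=> x Ux; apply: differentiableM; [exact: fd|exact: gd].
(* By Leibniz' rule; in each term the factor left underived is one order smoother than required, so
   [Ck_onW] lowers it. *)
move=> v; have H : Ck_on k U (fun x => f x * 'D_v g x + g x * 'D_v f x).
  by apply: Ck_onD => //; apply: IHk; [exact: Ck_onW|exact: gk|exact: Ck_onW|exact: fk].
apply: Ck_on_eq H => // x /set_mem Ux.
by rewrite deriveM//; apply: diff_derivable; [exact: fd|exact: gd].
Qed.

Lemma Ck_onZl V W k (U : set V) (f : V -> R) (w : W) : open U ->
  Ck_on k U f -> Ck_on k U (fun x => f x *: w).
Proof.
move=> oU; elim: k f => [|k IHk] f.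
  by move=> fc x Ux; apply: continuousZr_tmp; exact: fc.
case=> fd fk; split.
  by move=> x Ux; apply: differentiableZl; exact: fd.
move=> v; apply: Ck_on_eq (IHk _ (fk v)) => // x /set_mem Ux.
have fdx := fd x Ux.
by rewrite !deriveE ?diffZl//; exact: differentiableZl.
Qed.

Lemma differentiable_sqrt (r : R) : 0 < r -> differentiable (@Num.sqrt R) r.
Proof.
by move=> r0; apply/derivable1_diffP; have [] := is_derive1_sqrt r0.
Qed.

(* The derivative of [1 / sqrt q] is again a polynomial in [1 / sqrt q] and the
   derivative of [q], so no general chain rule for [Ck_on] is needed. *)
Lemma Ck_on_rsqrt V k (U : set V) (q : V -> R) : open U ->
  (forall x, U x -> 0 < q x) ->
  Ck_on k U q -> Ck_on k U (fun x => (Num.sqrt (q x))^-1).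
Proof.
move=> oU q0; elim: k => [|k IHk] qC.
  move=> x Ux; apply: continuousV; first by rewrite gt_eqF// sqrtr_gt0 q0.
  by apply: continuous_comp; [exact: qC|exact: sqrt_continuous].
have [qd qk] := qC.
have sd x : U x -> differentiable (@Num.sqrt R \o q) x.
  by move=> Ux; apply: differentiable_comp; [exact: qd|exact/differentiable_sqrt/q0].
have sn0 x : U x -> (@Num.sqrt R \o q) x != 0.
  by move=> Ux; rewrite gt_eqF//= sqrtr_gt0 q0.
split=> [x Ux|v].
  exact: (@differentiableV _ _ (@Num.sqrt R \o q)) (sd x Ux) (sn0 x Ux).
have sC := IHk (Ck_onW _ _ _ _ _ qC).
set s := (fun x => _) in sC.
(* With s = q^(-1/2), the derivative along v is -(1/2) s^3 times that of q. *)
have H : Ck_on k U (fun x => - 2^-1 * (s x * (s x * (s x * 'D_v q x)))).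
  apply: Ck_onM => //; first exact: Ck_on_cst.
  by do 3![apply: Ck_onM => //]; exact: qk.
apply: Ck_on_eq H => // x /set_mem Ux.
have dqx := qd x Ux; have dsx := differentiable_sqrt _ (q0 x Ux).
have Dsq : 'D_v (@Num.sqrt R \o q) x = 'D_v q x * (2 * Num.sqrt (q x))^-1.
  rewrite deriveE; last exact: sd.
  rewrite diff_comp// /= (diff1E dsx) derive1E derive_sqrt ?q0//.
  by rewrite (deriveE _ dqx).
rewrite /s (@deriveV _ _ (@Num.sqrt R \o q)) ?sn0//; last exact/diff_derivable/sd.
rewrite Dsq !fctE /= /cst.
have := sn0 x Ux; rewrite /= => n0.
by rewrite /GRing.scale /=; field.
Qed.

Lemma Ck_onN V W k (U : set V) (f : V -> W) : open U ->
  Ck_on k U f -> Ck_on k U (fun x => - f x).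
Proof.
move=> oU; elim: k f => [|k IHk] f.
  by move=> fc x Ux; apply: continuousN; exact: fc.
case=> fd fk; split; first by move=> x Ux; apply: differentiableN; exact: fd.
move=> v; apply: Ck_on_eq (IHk _ (fk v)) => // x /set_mem Ux.
by rewrite [RHS]deriveN//; apply: diff_derivable; exact: fd.
Qed.

Lemma Ck_on_pair V W W' k (U : set V) (f : V -> W) (g : V -> W') : open U ->
  Ck_on k U f -> Ck_on k U g -> Ck_on k U (fun x => (f x, g x)).
Proof.
move=> oU; elim: k f g => [|k IHk] f g.
  by move=> fc gc x Ux; apply: cvg_pair; [exact: fc|exact: gc].
case=> fd fk [gd gk]; split.
  by move=> x Ux; apply: differentiable_pair; [exact: fd|exact: gd].
move=> v; apply: Ck_on_eq (IHk _ _ (fk v) (gk v)) => // x /set_mem Ux.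
have [fdx gdx] := (fd x Ux, gd x Ux).
by rewrite !deriveE//= ?diff_pair//; exact: differentiable_pair.
Qed.

(** Bundles a plain function with its linearity, so that coordinates and projections written as
    lambdas fall under [Ck_on_linear]. *)
Lemma Ck_on_islinear V W k (U : set V) (f : V -> W) :
  linear f -> continuous f -> Ck_on k U f.
Proof.
move=> lf cf; pose fM := GRing.isLinear.Build _ _ _ _ f lf.
pose fL : {linear V -> W} := HB.pack f fM.
exact: (@Ck_on_linear V W k U fL cf).
Qed.

Lemma Ck_on_coord m n k (U : set 'M[R]_(m, n)) i j :
  Ck_on k U (fun M => M i j : R).
Proof.
apply: Ck_on_islinear; last exact: coord_continuous.
by move=> a M N; rewrite !mxE.
Qed.

Lemma Ck_on_mx V m n k (U : set V) (F : V -> 'M[R]_(m, n)) : open U ->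
  (forall i j, Ck_on k U (fun x => F x i j : R)) -> Ck_on k U F.
Proof.
move=> oU FC; rewrite (_ : F = fun x => \sum_i \sum_j F x i j *: delta_mx i j).
  by do 2![apply: Ck_on_sum => // ? _]; exact: Ck_onZl.
by apply/funext => x; rewrite -matrix_sum_delta.
Qed.

(** Matrix rules from here on assume and conclude smoothness of entries, so that they chain;
    [Ck_on_mx] returns to matrix-valued maps at the end. *)
Lemma Ck_on_mulmx (V : normedModType R) k (U : set V) m n p
    (A : V -> 'M[R]_(m, n)) (B : V -> 'M[R]_(n, p)) : open U ->
  (forall i j, Ck_on k U (fun x => A x i j : R)) ->
  (forall i j, Ck_on k U (fun x => B x i j : R)) ->
  forall i j, Ck_on k U (fun x => (A x *m B x) i j : R).
Proof.
move=> oU AC BC i j.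
rewrite (_ : (fun x => _) = fun x => \sum_l A x i l * B x l j).
  by apply: Ck_on_sum => // l _; exact: Ck_onM.
by apply/funext => x; rewrite mxE.
Qed.

Lemma Ck_on_submx (V : normedModType R) k (U : set V) m n
    (A B : V -> 'M[R]_(m, n)) : open U ->
  (forall i j, Ck_on k U (fun x => A x i j : R)) ->
  (forall i j, Ck_on k U (fun x => B x i j : R)) ->
  forall i j, Ck_on k U (fun x => (A x - B x) i j : R).
Proof.
move=> oU AC BC i j; rewrite (_ : (fun x => _) = fun x => A x i j + - B x i j).
  by apply: Ck_onD => //; exact: Ck_onN.
by apply/funext => x; rewrite !mxE.
Qed.

Lemma Ck_on_smooth_on (V W : normedModType R) (A U : set V) (f : V -> W) :
  open U -> A `<=` U -> (forall k, Ck_on k U f) -> smooth_on A f.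
Proof. by move=> oU AU fC x Ax; exists U, f; split=> //; exact: AU. Qed.

End Smoothness.

(** * Classification of the complex structures *)

(* [A], [b], [l], [c] are the blocks of a 4 x 4 matrix [J = (A, b; l, c)]. With
   [K] the matrix of the cross product by [b], the hypotheses [Cij] and [Li] are
   the vanishing of the Nijenhuis tensor on pairs [(X, J4)], that is
   [A K = K A] and [l] parallel to [b]; the others are entries of [J^2 = -1]. *)
Lemma acs_entries (F : realFieldType)
    (a00 a01 a02 a10 a11 a12 a20 a21 a22 b0 b1 b2 c l0 l1 l2 : F)
    (N := b0 ^+ 2 + b1 ^+ 2 + b2 ^+ 2)
    (C00 : a01 * b2 - a02 * b1 = b1 * a20 - b2 * a10)
    (C01 : a02 * b0 - a00 * b2 = b1 * a21 - b2 * a11)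
    (C02 : a00 * b1 - a01 * b0 = b1 * a22 - b2 * a12)
    (C10 : a11 * b2 - a12 * b1 = b2 * a00 - b0 * a20)
    (C11 : a12 * b0 - a10 * b2 = b2 * a01 - b0 * a21)
    (C12 : a10 * b1 - a11 * b0 = b2 * a02 - b0 * a22)
    (C20 : a21 * b2 - a22 * b1 = b0 * a10 - b1 * a00)
    (C21 : a22 * b0 - a20 * b2 = b0 * a11 - b1 * a01)
    (C22 : a20 * b1 - a21 * b0 = b0 * a12 - b1 * a02)
    (E0 : a00 * b0 + a01 * b1 + a02 * b2 + b0 * c = 0)
    (E1 : a10 * b0 + a11 * b1 + a12 * b2 + b1 * c = 0)
    (E2 : a20 * b0 + a21 * b1 + a22 * b2 + b2 * c = 0)
    (S00 : a00 * a00 + a01 * a10 + a02 * a20 + b0 * l0 = -1)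
    (S01 : a00 * a01 + a01 * a11 + a02 * a21 + b0 * l1 = 0)
    (S02 : a00 * a02 + a01 * a12 + a02 * a22 + b0 * l2 = 0)
    (S10 : a10 * a00 + a11 * a10 + a12 * a20 + b1 * l0 = 0)
    (S11 : a10 * a01 + a11 * a11 + a12 * a21 + b1 * l1 = -1)
    (S12 : a10 * a02 + a11 * a12 + a12 * a22 + b1 * l2 = 0)
    (S20 : a20 * a00 + a21 * a10 + a22 * a20 + b2 * l0 = 0)
    (S21 : a20 * a01 + a21 * a11 + a22 * a21 + b2 * l1 = 0)
    (S22 : a20 * a02 + a21 * a12 + a22 * a22 + b2 * l2 = -1)
    (L0 : l1 * b2 = l2 * b1)
    (L1 : l2 * b0 = l0 * b2)
    (L2 : l0 * b1 = l1 * b0)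
    (T : l0 * b0 + l1 * b1 + l2 * b2 + c * c = -1) :
  N != 0 /\ exists t, [/\ t ^+ 2 = N,
   [/\ a00 = (- c * b0 * b0) / N,
       a01 = (- c * b0 * b1 - t * b2) / N &
       a02 = (- c * b0 * b2 + t * b1) / N],
   [/\ a10 = (- c * b1 * b0 + t * b2) / N,
       a11 = (- c * b1 * b1) / N &
       a12 = (- c * b1 * b2 - t * b0) / N],
   [/\ a20 = (- c * b2 * b0 - t * b1) / N,
       a21 = (- c * b2 * b1 + t * b0) / N &
       a22 = (- c * b2 * b2) / N] &
   [/\ l0 = - (1 + c ^+ 2) * b0 / N,
       l1 = - (1 + c ^+ 2) * b1 / N &
       l2 = - (1 + c ^+ 2) * b2 / N]].
Proof.
have N0 : N != 0.
  (* If b = 0, then [T] reads c^2 = -1. *)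
  apply/negP; rewrite !paddr_eq0 ?addr_ge0 ?sqr_ge0// !sqrf_eq0.
  case/andP=> /andP[/eqP b00 /eqP b10] /eqP b20.
  move: T (sqr_ge0 c); rewrite b00 b10 b20 !mulr0 !add0r expr2 => ->.
  by rewrite ler0N1.
have divN (a x : F) : N * a = x -> a = x / N by move=> <-; rewrite mulrC mulKf.
(* Since l is parallel to b, N l = (l . b) b, and [T] gives l . b = -(1 + c^2). *)
have El0 : l0 = - (1 + c ^+ 2) * b0 / N.
  apply: divN; transitivity (b0 * (l0 * b0 + l1 * b1 + l2 * b2 + c * c)
    - c ^+ 2 * b0 + b1 * (l0 * b1 - l1 * b0) - b2 * (l2 * b0 - l0 * b2)).
    by rewrite /N; ring.
  by rewrite T L1 L2; ring.
have El1 : l1 = - (1 + c ^+ 2) * b1 / N.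
  apply: divN; transitivity (b1 * (l0 * b0 + l1 * b1 + l2 * b2 + c * c)
    - c ^+ 2 * b1 - b0 * (l0 * b1 - l1 * b0) + b2 * (l1 * b2 - l2 * b1)).
    by rewrite /N; ring.
  by rewrite T L0 L2; ring.
have El2 : l2 = - (1 + c ^+ 2) * b2 / N.
  apply: divN; transitivity (b2 * (l0 * b0 + l1 * b1 + l2 * b2 + c * c)
    - c ^+ 2 * b2 + b0 * (l2 * b0 - l0 * b2) - b1 * (l1 * b2 - l2 * b1)).
    by rewrite /N; ring.
  by rewrite T L0 L1; ring.
(* [A] commutes with [K] and [A b = - c b], so
   [N A = - c b b^T + p (N - b b^T) + t K]. This is a linear consequence of the
   [Cij] and [Ei]; the coefficients solve a linear system. *)
pose p := (a00 + a11 + a22 + c) / 2.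
pose t := (b0 * (a21 - a12) + b1 * (a02 - a20) + b2 * (a10 - a01)) / 2.
(* Each hypothesis [Cij], [Ei] gets a name for its defect, so that the linear combinations below are
   identities in free variables, checked before the defects are set to 0. *)
pose c00 := a01 * b2 - a02 * b1 - (b1 * a20 - b2 * a10).
have C000 : c00 = 0 by rewrite /c00 C00 subrr.
pose c01 := a02 * b0 - a00 * b2 - (b1 * a21 - b2 * a11).
have C010 : c01 = 0 by rewrite /c01 C01 subrr.
pose c02 := a00 * b1 - a01 * b0 - (b1 * a22 - b2 * a12).
have C020 : c02 = 0 by rewrite /c02 C02 subrr.
pose c10 := a11 * b2 - a12 * b1 - (b2 * a00 - b0 * a20).
have C100 : c10 = 0 by rewrite /c10 C10 subrr.
pose c11 := a12 * b0 - a10 * b2 - (b2 * a01 - b0 * a21).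
have C110 : c11 = 0 by rewrite /c11 C11 subrr.
pose c12 := a10 * b1 - a11 * b0 - (b2 * a02 - b0 * a22).
have C120 : c12 = 0 by rewrite /c12 C12 subrr.
pose c20 := a21 * b2 - a22 * b1 - (b0 * a10 - b1 * a00).
have C200 : c20 = 0 by rewrite /c20 C20 subrr.
pose c21 := a22 * b0 - a20 * b2 - (b0 * a11 - b1 * a01).
have C210 : c21 = 0 by rewrite /c21 C21 subrr.
pose c22 := a20 * b1 - a21 * b0 - (b0 * a12 - b1 * a02).
have C220 : c22 = 0 by rewrite /c22 C22 subrr.
pose e0 := a00 * b0 + a01 * b1 + a02 * b2 + b0 * c.
have E00 : e0 = 0 by exact: E0.
pose e1 := a10 * b0 + a11 * b1 + a12 * b2 + b1 * c.
have E10 : e1 = 0 by exact: E1.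
pose e2 := a20 * b0 + a21 * b1 + a22 * b2 + b2 * c.
have E20 : e2 = 0 by exact: E2.
have A00 : a00 = (- c * b0 * b0 + p * (N - b0 * b0)) / N.
  apply/divN/eqP; rewrite -subr_eq0; apply/eqP.
  transitivity (c02 * b1 + 1 / 2 * c10 * b2 + e0 * b0 - c01 * b2
    - 1 / 2 * c20 * b1 - 1 / 2 * e1 * b1 - 1 / 2 * e2 * b2).
    by rewrite /c01 /c02 /c10 /c20 /e0 /e1 /e2 /N /p /t; field.
  by rewrite C010 C020 C100 C200 E00 E10 E20; ring.
have A01 : a01 = (- c * b0 * b1 - p * b0 * b1 - t * b2) / N.
  apply/divN/eqP; rewrite -subr_eq0; apply/eqP.
  transitivity (c00 * b2 + 1 / 2 * c11 * b2 + 3 / 2 * e0 * b1 - c02 * b0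
    - 1 / 2 * c21 * b1).
    by rewrite /c00 /c02 /c11 /c21 /e0 /N /p /t; field.
  by rewrite C000 C020 C110 C210 E00; ring.
have A02 : a02 = (- c * b0 * b2 - p * b0 * b2 + t * b1) / N.
  apply/divN/eqP; rewrite -subr_eq0; apply/eqP.
  transitivity (c01 * b0 + 1 / 2 * c11 * b1 + 1 / 2 * c12 * b2
    + 3 / 2 * e0 * b2 - 1 / 2 * c00 * b1).
    by rewrite /c00 /c01 /c11 /c12 /e0 /N /p /t; field.
  by rewrite C000 C010 C110 C120 E00; ring.
have A10 : a10 = (- c * b1 * b0 - p * b1 * b0 + t * b2) / N.
  apply/divN/eqP; rewrite -subr_eq0; apply/eqP.
  transitivity (c00 * b2 + 1 / 2 * c11 * b2 + c12 * b1 + 3 / 2 * e0 * b1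
    - c20 * b0 - 3 / 2 * c21 * b1).
    by rewrite /c00 /c11 /c12 /c20 /c21 /e0 /N /p /t; field.
  by rewrite C000 C110 C120 C200 C210 E00; ring.
have A11 : a11 = (- c * b1 * b1 + p * (N - b1 * b1)) / N.
  apply/divN/eqP; rewrite -subr_eq0; apply/eqP.
  transitivity (1 / 2 * c10 * b2 + 1 / 2 * c20 * b1 + e1 * b1
    - 1 / 2 * c02 * b1 - 1 / 2 * c12 * b0 - 1 / 2 * e0 * b0
    - 1 / 2 * e2 * b2).
    by rewrite /c02 /c10 /c12 /c20 /e0 /e1 /e2 /N /p /t; field.
  by rewrite C020 C100 C120 C200 E00 E10 E20; ring.
have A12 : a12 = (- c * b1 * b2 - p * b1 * b2 - t * b0) / N.
  apply/divN/eqP; rewrite -subr_eq0; apply/eqP.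
  transitivity (1 / 2 * c11 * b0 + 3 / 2 * e1 * b2 - 1 / 2 * c00 * b0
    - 1 / 2 * c02 * b2 - c10 * b1).
    by rewrite /c00 /c02 /c10 /c11 /e1 /N /p /t; field.
  by rewrite C000 C020 C100 C110 E10; ring.
have A20 : a20 = (- c * b2 * b0 - p * b2 * b0 - t * b1) / N.
  apply/divN/eqP; rewrite -subr_eq0; apply/eqP.
  transitivity (c10 * b0 + 1 / 2 * c11 * b1 + 3 / 2 * c12 * b2
    + 3 / 2 * e0 * b2 - 1 / 2 * c00 * b1 - c21 * b2).
    by rewrite /c00 /c10 /c11 /c12 /c21 /e0 /N /p /t; field.
  by rewrite C000 C100 C110 C120 C210 E00; ring.
have A21 : a21 = (- c * b2 * b1 - p * b2 * b1 + t * b0) / N.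
  apply/divN/eqP; rewrite -subr_eq0; apply/eqP.
  transitivity (1 / 2 * c11 * b0 + c20 * b2 + 3 / 2 * e1 * b2
    - 1 / 2 * c00 * b0 - c01 * b1 - 3 / 2 * c02 * b2).
    by rewrite /c00 /c01 /c02 /c11 /c20 /e1 /N /p /t; field.
  by rewrite C000 C010 C020 C110 C200 E10; ring.
have A22 : a22 = (- c * b2 * b2 + p * (N - b2 * b2)) / N.
  apply/divN/eqP; rewrite -subr_eq0; apply/eqP.
  transitivity (c01 * b2 + 1 / 2 * c12 * b0 + e2 * b2 - 1 / 2 * c02 * b1
    - c10 * b2 - 1 / 2 * e0 * b0 - 1 / 2 * e1 * b1).
    by rewrite /c01 /c02 /c10 /c12 /e0 /e1 /e2 /N /p /t; field.
  by rewrite C010 C020 C100 C120 E00 E10 E20; ring.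
clearbody p t.
pose AE := (A00, A01, A02, A10, A11, A12, A20, A21, A22, El0, El1, El2).
(* On the plane orthogonal to b, A acts as the complex number p + i t / |b|, whose square has to be
   -1. The real part comes from the trace of the upper left block of J^2 = -1. *)
have ptN : p ^+ 2 * N - t ^+ 2 = - N.
  have : (p ^+ 2 * N - t ^+ 2 + N) * 2 = 0.
    transitivity (N * ((a00 * a00 + a01 * a10 + a02 * a20 + b0 * l0)
      + (a10 * a01 + a11 * a11 + a12 * a21 + b1 * l1)
      + (a20 * a02 + a21 * a12 + a22 * a22 + b2 * l2) + 3)).
      by rewrite !AE /N; field; exact: N0.
    by rewrite S00 S11 S22; ring.
  by move=> /eqP; rewrite mulf_eq0 pnatr_eq0 orbF addr_eq0 => /eqP.
(* The imaginary part: the antisymmetric part of A^2 is 2 p t K / N, while b l^T is symmetric. Each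
   difference of opposite entries, times N, is -4 p t times a coordinate of b. *)
have zero (x y : F) : x = 0 -> x = - 4 * y -> y = 0.
  by move=> ->; lra.
have pt2 : p * t * b2 = 0.
  apply: (zero (N * ((a00 * a01 + a01 * a11 + a02 * a21 + b0 * l1)
    - (a10 * a00 + a11 * a10 + a12 * a20 + b1 * l0)))).
    by rewrite S01 S10; ring.
  by rewrite !AE /N; field; exact: N0.
have pt1 : p * t * b1 = 0.
  apply: (zero (N * ((a20 * a00 + a21 * a10 + a22 * a20 + b2 * l0)
    - (a00 * a02 + a01 * a12 + a02 * a22 + b0 * l2)))).
    by rewrite S02 S20; ring.
  by rewrite !AE /N; field; exact: N0.
have pt0 : p * t * b0 = 0.
  apply: (zero (N * ((a10 * a02 + a11 * a12 + a12 * a22 + b1 * l2)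
    - (a20 * a01 + a21 * a11 + a22 * a21 + b2 * l1)))).
    by rewrite S12 S21; ring.
  by rewrite !AE /N; field; exact: N0.
have pt : p * t = 0.
  apply: (mulIf N0); rewrite mul0r.
  transitivity (p * t * b0 * b0 + p * t * b1 * b1 + p * t * b2 * b2).
    by rewrite /N; ring.
  by rewrite pt0 pt1 pt2 !mul0r !addr0.
(* The case t = 0 would give p^2 = -1. So p = 0, and then t^2 = N. *)
have p0 : p = 0.
  move/eqP : pt; rewrite mulf_eq0 => /orP[/eqP//|/eqP t0].
  move: ptN (sqr_ge0 p); rewrite t0 expr0n/= subr0 -mulN1r => /(mulIf N0) ->.
  by rewrite ler0N1.
clear AE; move: ptN A00 A01 A02 A10 A11 A12 A20 A21 A22; rewrite p0 expr0n/= !mul0r.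
rewrite !subr0 !addr0 sub0r => /oppr_inj t2 *.
by split=> //; exists t.
Qed.

Section Classification.
Context {R : realType}.

(** Indices are normalized to [inord k], the form in which [u2_bracket] reads coordinates. *)
Lemma ord4_ind (P : 'I_4 -> Prop) :
  P (inord 0) -> P (inord 1) -> P (inord 2) -> P (inord 3) -> forall i, P i.
Proof.
move=> P0 P1 P2 P3 i; rewrite -(inord_val i).
by case: i => -[|[|[|[|]]]].
Qed.

Lemma big_ord4 (V : nmodType) (f : 'I_4 -> V) :
  \sum_i f i = f (inord 0) + f (inord 1) + f (inord 2) + f (inord 3).
Proof.
rewrite !big_ord_recl big_ord0 addr0 !addrA.
by do 3?[congr (_ + _)]; congr f; apply/val_inj; rewrite /= inordK.
Qed.

Lemma mulmx4E (M : 'M[R]_4) (X : 'cV[R]_4) i :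
  (M *m X) i ord0 = M i (inord 0) * X (inord 0) ord0
    + M i (inord 1) * X (inord 1) ord0
    + M i (inord 2) * X (inord 2) ord0 + M i (inord 3) * X (inord 3) ord0.
Proof. by rewrite mxE big_ord4. Qed.

Lemma u2_bracketE (X Y : 'cV[R]_4) :
  let x k := X (inord k) ord0 in let y k := Y (inord k) ord0 in
  [/\ u2_bracket X Y (inord 0) ord0 = x 1%N * y 2%N - x 2%N * y 1%N,
      u2_bracket X Y (inord 1) ord0 = x 2%N * y 0%N - x 0%N * y 2%N,
      u2_bracket X Y (inord 2) ord0 = x 0%N * y 1%N - x 1%N * y 0%N &
      u2_bracket X Y (inord 3) ord0 = 0].
Proof.
move=> x y; rewrite /x /y.
by split; rewrite !mxE -!val_eqE /= !inordK//= ?(mulr0n, mulr1n); ring.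
Qed.

(** This is |b|^2 for a last column w = (b, c). *)
Definition sqnorm3 (w : 'cV[R]_4) : R :=
  w (inord 0) ord0 ^+ 2 + w (inord 1) ord0 ^+ 2 + w (inord 2) ord0 ^+ 2.

(* Entries of the complex structure with last column [(b, c)] and sign [e], where
   [s] stands for [1 / |b|]. For [b = 0] the junk value [s = 0] is never used. *)
Definition acs_entry (e b0 b1 b2 c s : R) (i j : nat) : R :=
  nth 0 (nth [::] [::
    [:: - c * (s * b0) * (s * b0); - c * (s * b0) * (s * b1) - e * (s * b2);
        - c * (s * b0) * (s * b2) + e * (s * b1); b0];
    [:: - c * (s * b1) * (s * b0) + e * (s * b2); - c * (s * b1) * (s * b1);
        - c * (s * b1) * (s * b2) - e * (s * b0); b1];
    [:: - c * (s * b2) * (s * b0) - e * (s * b1);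
        - c * (s * b2) * (s * b1) + e * (s * b0);
        - c * (s * b2) * (s * b2); b2];
    [:: - (1 + c * c) * s * (s * b0); - (1 + c * c) * s * (s * b1);
        - (1 + c * c) * s * (s * b2); c]] i) j.

Definition acs (e : R) (w : 'cV[R]_4) : 'M[R]_4 :=
  \matrix_(i, j) acs_entry e (w (inord 0) ord0) (w (inord 1) ord0)
    (w (inord 2) ord0) (w (inord 3) ord0) (Num.sqrt (sqnorm3 w))^-1 i j.

Lemma sqnorm3_ge0 w : 0 <= sqnorm3 w.
Proof. by rewrite !addr_ge0 ?sqr_ge0. Qed.

Lemma acsE e w i j : (i < 4)%N -> (j < 4)%N ->
  acs e w (inord i) (inord j) =
  acs_entry e (w (inord 0) ord0) (w (inord 1) ord0)
    (w (inord 2) ord0) (w (inord 3) ord0) (Num.sqrt (sqnorm3 w))^-1 i j.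
Proof. by move=> i4 j4; rewrite mxE !inordK. Qed.

Lemma acs_col e w : col (inord 3) (acs e w) = w.
Proof. by apply/colP; apply: ord4_ind; rewrite !mxE !inordK. Qed.

(** Each coordinate of both conditions is a polynomial identity modulo e^2 = 1 and s^2 |b|^2 = 1. *)
Lemma acs_complex_structure e w : e ^+ 2 = 1 -> sqnorm3 w != 0 ->
  u2_complex_structures (acs e w).
Proof.
move=> e1 w0.
set b0 := w (inord 0) ord0; set b1 := w (inord 1) ord0.
set b2 := w (inord 2) ord0; set c := w (inord 3) ord0.
set s := (Num.sqrt (sqnorm3 w))^-1.
have ee : e * e = 1 by rewrite -expr2.
(* The relation s^2 |b|^2 = 1 is solved for one monomial, as [ring] needs to use it for
   rewriting. *)
have sb : s * s * b0 * b0 = 1 - s * s * b1 * b1 - s * s * b2 * b2.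
  have sN : s * s * sqnorm3 w = 1.
    by rewrite -expr2 exprVn sqr_sqrtr ?sqnorm3_ge0// mulVf.
  by rewrite -sN /sqnorm3 -/b0 -/b1 -/b2; ring.
have aE i j : (i < 4)%N -> (j < 4)%N ->
    acs e w (inord i) (inord j) = acs_entry e b0 b1 b2 c s i j.
  exact: acsE.
clearbody s b0 b1 b2 c; clear w0 e1.
split=> [X|X Y].
  move: (acs e w) aE => M aE /=; apply/colP.
  by apply: ord4_ind; rewrite !mulmx4E !aE//= /acs_entry /= [RHS]mxE; ring: ee sb.
move: (acs e w) aE => M aE /=; apply/colP.
have sub (A B : 'cV[R]_4) i : (A - B) i ord0 = A i ord0 - B i ord0.
  by rewrite !mxE.
have [JJ0 JJ1 JJ2 JJ3] := u2_bracketE (M *m X) (M *m Y).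
have [b0E b1E b2E b3E] := u2_bracketE X Y.
have [JI0 JI1 JI2 JI3] := u2_bracketE (M *m X) Y.
have [IJ0 IJ1 IJ2 IJ3] := u2_bracketE X (M *m Y).
apply: ord4_ind; rewrite [RHS]mxE !sub !mulmx4E ?(JJ0, JJ1, JJ2, JJ3)
  ?(b0E, b1E, b2E, b3E) JI0 JI1 JI2 JI3 IJ0 IJ1 IJ2 IJ3 !mulmx4E !aE//=
  /acs_entry /=; ring: ee sb.
Qed.

Lemma u2_complex_structureP (M : 'M[R]_4) : u2_complex_structures M <->
  sqnorm3 (col (inord 3) M) != 0 /\ exists2 e, e ^+ 2 = 1 & M = acs e (col (inord 3) M).
Proof.
split=> [|[w0 [e e1 ->]]]; last exact: acs_complex_structure.
case=> /= MM NM.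
have sq i j : (i < 4)%N -> (j < 4)%N ->
    M (inord i) (inord 0) * M (inord 0) (inord j)
    + M (inord i) (inord 1) * M (inord 1) (inord j)
    + M (inord i) (inord 2) * M (inord 2) (inord j)
    + M (inord i) (inord 3) * M (inord 3) (inord j) = - (i == j)%:R.
  move=> i4 j4.
  have := congr1 (fun A : 'cV[R]_4 => A (inord i) ord0) (MM (u2_basis (inord j))).
  rewrite [RHS]mxE u2_basisE// eq_sym => <-.
  have colE k : (M *m u2_basis (inord j)) (inord k) ord0 = M (inord k) (inord j).
    by rewrite /u2_basis -colE mxE.
  by rewrite mulmx4E !colE.
(* J4 is central, so two of the four Nijenhuis terms on (X, J4) vanish, leaving [JX, J J4] = J
   [X, J J4]. *)
have nij i k : (i < 3)%N -> (k < 4)%N ->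
    (u2_bracket (M *m u2_basis (inord i)) (M *m u2_basis (inord 3))) (inord k) ord0
    = (M *m u2_bracket (u2_basis (inord i)) (M *m u2_basis (inord 3))) (inord k) ord0.
  move=> i3 k4; have := NM (u2_basis (inord i)) (u2_basis (inord 3)).
  have [_ _ _ central] := @u2_bracket_basis R.
  by rewrite !central mulmx0 !subr0 => /subr0_eq ->.
pose m i j := M (inord i) (inord j).
have colM k j : (M *m u2_basis (inord j)) (inord k) ord0 = m k j.
  by rewrite /u2_basis -colE mxE.
(* In coordinates, with [y] the cross product of the i-th basis vector by b: the first three rows
   say that A commutes with K, the fourth that l is orthogonal to every such [y], hence parallel to
   b. *)
have comm i : (i < 3)%N ->
  let x k : R := (i == k)%:R in
  let y := [:: x 1%N * m 2%N 3%N - x 2%N * m 1%N 3%N;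
               x 2%N * m 0%N 3%N - x 0%N * m 2%N 3%N;
               x 0%N * m 1%N 3%N - x 1%N * m 0%N 3%N] in
  let My k := m k 0%N * y`_0 + m k 1%N * y`_1 + m k 2%N * y`_2 in
  [/\ m 1%N i * m 2%N 3%N - m 2%N i * m 1%N 3%N = My 0%N,
      m 2%N i * m 0%N 3%N - m 0%N i * m 2%N 3%N = My 1%N,
      m 0%N i * m 1%N 3%N - m 1%N i * m 0%N 3%N = My 2%N &
      0 = My 3%N].
  move=> i3 x y My.
  have [L0 L1 L2 L3] := u2_bracketE (M *m u2_basis (inord i)) (M *m u2_basis (inord 3)).
  have [K0 K1 K2 K3] := u2_bracketE (u2_basis (inord i)) (M *m u2_basis (inord 3)).
  have i4 := ltnW i3; have := nij i ^~ i3; rewrite /My /y /x /=.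
  move=> H; have := (H 0%N isT, H 1%N isT, H 2%N isT, H 3%N isT).
  rewrite L0 L1 L2 L3 !(mulmx4E M (u2_bracket _ _)) K0 K1 K2 K3 !colM.
  rewrite !u2_basisE// !mulr0 !addr0.
  by case=> [[[-> ->] ->] ->].
have {nij} [P00 P01 P02 P03] := comm 0%N isT.
have [P10 P11 P12 P13] := comm 1%N isT.
have {comm} [P20 P21 P22 P23] := comm 2%N isT.
have msq i j : (i < 4)%N -> (j < 4)%N -> m i 0%N * m 0%N j + m i 1%N * m 1%N j
    + m i 2%N * m 2%N j + m i 3%N * m 3%N j = - (i == j)%:R by exact: sq.
rewrite /= !(mul1r, mul0r, subr0, sub0r, oppr0, mulr0, addr0, add0r, mulrN)
  in P00 P01 P02 P03 P10 P11 P12 P13 P20 P21 P22 P23.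
have /= Q00 := msq 0%N 0%N isT isT.
have /= Q01 := msq 0%N 1%N isT isT.
have /= Q02 := msq 0%N 2%N isT isT.
have /= Q03 := msq 0%N 3%N isT isT.
have /= Q10 := msq 1%N 0%N isT isT.
have /= Q11 := msq 1%N 1%N isT isT.
have /= Q12 := msq 1%N 2%N isT isT.
have /= Q13 := msq 1%N 3%N isT isT.
have /= Q20 := msq 2%N 0%N isT isT.
have /= Q21 := msq 2%N 1%N isT isT.
have /= Q22 := msq 2%N 2%N isT isT.
have /= Q23 := msq 2%N 3%N isT isT.
have /= Q33 := msq 3%N 3%N isT isT.
have := acs_entries R (m 0%N 0%N) (m 0%N 1%N) (m 0%N 2%N) (m 1%N 0%N) (m 1%N 1%N)
  (m 1%N 2%N) (m 2%N 0%N) (m 2%N 1%N) (m 2%N 2%N) (m 0%N 3%N) (m 1%N 3%N)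
  (m 2%N 3%N) (m 3%N 3%N) (m 3%N 0%N) (m 3%N 1%N) (m 3%N 2%N).
(* Each hypothesis of [acs_entries] is one of these equations up to a linear rearrangement, products
   counting as atoms. *)
case; [move: P00|move: P10|move: P20|move: P01|move: P11|move: P21|move: P02
  |move: P12|move: P22|move: Q03|move: Q13|move: Q23|move: Q00|move: Q01
  |move: Q02|move: Q10|move: Q11|move: Q12|move: Q20|move: Q21|move: Q22
  |move: P03|move: P13|move: P23|move: Q33|]; do ?[by clear; lra].
move=> N0 [t [t2 [A00 A01 A02] [A10 A11 A12] [A20 A21 A22] [A30 A31 A32]]].
set w := col (inord 3) M.
have wE k : w (inord k) ord0 = m k 3%N by rewrite mxE.
have NE : sqnorm3 w = m 0%N 3%N ^+ 2 + m 1%N 3%N ^+ 2 + m 2%N 3%N ^+ 2.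
  by rewrite /sqnorm3 !wE.
rewrite -NE in N0 t2 A00 A01 A02 A10 A11 A12 A20 A21 A22 A30 A31 A32.
split=> //; have aE := acsE _ w; rewrite !wE in aE.
have : (Num.sqrt (sqnorm3 w)) ^+ 2 = sqnorm3 w by rewrite sqr_sqrtr ?sqnorm3_ge0.
have r0 : Num.sqrt (sqnorm3 w) != 0 by rewrite sqrtr_eq0 -ltNge lt_def N0 sqnorm3_ge0.
(* The sign is t / |b|, since t^2 = |b|^2. *)
move: r0 aE; set r := Num.sqrt _ => r0 aE rE; exists (t / r).
  by rewrite expr_div_n t2 rE divff.
rewrite -rE in A00 A01 A02 A10 A11 A12 A20 A21 A22 A30 A31 A32.
apply/matrixP; apply: ord4_ind; apply: ord4_ind;
  rewrite aE// /acs_entry //= -/(m _ _) ?A00 ?A01 ?A02 ?A10 ?A11 ?A12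
    ?A20 ?A21 ?A22 ?A30 ?A31 ?A32; field; exact: r0.
Qed.

End Classification.

(** * The two graphs *)

Section Components.
Context {R : realType}.

(** * Topological preliminaries and connectedness of R x (R^3 minus 0) *)

Lemma open_preimage_on (T : topologicalType) (W : set T) (h : T -> R) (A : set R) :
  open W -> (forall x, W x -> {for x, continuous h}) -> open A ->
  open (W `&` h @^-1` A).
Proof.
move=> oW hc oA; rewrite openE => x [Wx Ahx]; apply: filterI.
  exact: open_nbhs_nbhs.
by apply: hc => //; exact: open_nbhs_nbhs.
Qed.

(** The set is the union of the segments from [p] to its points, which all contain [p]. *)
Lemma starshaped_connected (V : normedModType R) (A : set V) p : A p ->
  (forall x t, A x -> 0 <= t <= 1 -> A (p + t *: (x - p))) -> connected A.
Proof.
move=> Ap sA; pose seg x := (fun t : R => p + t *: (x - p)) @` `[0, 1].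
have -> : A = \bigcup_(x in A) seg x.
  apply/seteqP; split=> [x Ax|x [y Ay [t + <-]]].
    by exists x => //; exists 1; rewrite ?scale1r ?subrKC//= in_itv/= ler01 lexx.
  by rewrite /= in_itv/=; exact: sA.
apply: bigcup_connected.
  by exists p => x _; exists 0; rewrite ?scale0r ?addr0//= in_itv/= ler01 lexx.
move=> x _; apply: connected_continuous_connected; first exact: segment_connected.
apply: continuous_subspaceT => t; apply: cvgD; first exact: cvg_cst.
by apply: cvgZr_tmp; exact: cvg_id.
Qed.

(* The punctured space is the union of the complements of two opposite
   half-lines, which are star-shaped and meet. *)
Lemma connected_punctured :
  connected ([set: R^o] `*` [set v : 'rV[R]_3 | v != 0]).
Proof.
pose E (a : R) : 'rV[R]_3 := \row_j (if j == ord0 then a else 0).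
(* For a = 1 or -1, [A a] is the complement of R times the closed half-line from 0 in the direction
   of - [E a]; it is star-shaped about (0, [E a]). *)
pose A (a : R) := [set p : R^o * 'rV[R]_3 |
  [|| 0 < a * p.2 ord0 ord0, p.2 ord0 1 != 0 | p.2 ord0 (inord 2) != 0]].
have Ac a : a != 0 -> connected (A a).
  move=> a0; have a2 : 0 < a ^+ 2 by rewrite lt_def sqr_ge0 sqrf_eq0 a0.
  apply: (@starshaped_connected _ _ (0, E a)).
    by rewrite /A /= mxE eqxx -expr2 a2.
  move=> [c v] t; rewrite /A /= !mxE eqxx.
  have -> : ((1 : 'I_3) == ord0) = false by [].
  have -> : ((inord 2 : 'I_3) == ord0) = false by rewrite -val_eqE /= inordK.
  rewrite !add0r !subr0 !mulf_eq0 !negb_or.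
  (* At t = 0 the point is the centre, where the last two coordinates vanish; for t > 0 they stay
     nonzero if they were. *)
  have [->|t0] := eqVneq t 0; first by rewrite mul0r addr0 -expr2 a2.
  rewrite /=; move=> /or3P[H|->|->]; rewrite ?orbT// => /andP[t0' t1].
  apply/orP; left.
  have -> : a * (a + t * (v ord0 ord0 - a))
      = (1 - t) * a ^+ 2 + t * (a * v ord0 ord0) by ring.
  apply: ltr_wpDl; first by rewrite mulr_ge0 ?subr_ge0 ?sqr_ge0.
  by rewrite mulr_gt0// lt_def t0.
have -> : [set: R^o] `*` [set v : 'rV[R]_3 | v != 0] = A 1 `|` A (-1).
  apply/seteqP; split=> [[c v] [_ /= v0]|[c v]].
    have [v00|v00|v00] := ltgtP 0 (v ord0 ord0).
    - by left; rewrite /A/= mul1r v00.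
    - by right; rewrite /A/= mulN1r oppr_gt0 v00.
    left; rewrite /A /= -negb_and; apply/orP; right.
    apply: contra v0 => /andP[/eqP v1 /eqP v2].
    apply/eqP/rowP => -[[|[|[|//]]] H]; rewrite mxE.
    - by rewrite [RHS]v00; congr (v _ _); exact/val_inj.
    - by rewrite -v1; congr (v _ _); exact/val_inj.
    - by rewrite -v2; congr (v _ _); apply/val_inj; rewrite /= inordK.
  move=> H; split=> //=; apply/eqP => v0; move: H.
  by rewrite v0 /A /= !mxE !mulr0 ltxx eqxx; case.
apply: connectedU; [|by apply: Ac; rewrite oner_neq0
  |by apply: Ac; rewrite oppr_eq0 oner_neq0].
by exists (0, \row_(j < 3) 1); rewrite /A /= !mxE oner_neq0 !orbT; split.
Qed.

Lemma card_set2_II (T : Type) (a b : T) : a <> b -> ([set a; b] #= `I_2)%card.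
Proof.
move=> ab; apply/pcard_eqP/bijPex.
exists (fun x => if pselect (x = a) then 0%N else 1%N); split.
- by move=> x _ /=; case: pselect => ? /=.
- by move=> x y /set_mem[]-> /set_mem[]-> //;
    case: pselect => //= ?; case: pselect => //= ?; case: ab.
- case=> [|[|//]] _; [exists a|exists b]; rewrite /=; do ?[by left|by right];
    case: pselect => // ba.
  by case: ab.
Qed.

(** * Closedness *)

Lemma Ck_on_u2_bracket (V : normedModType R) k (U : set V)
    (X Y : V -> 'cV[R]_4) : open U ->
  (forall i j, Ck_on k U (fun x => X x i j : R)) ->
  (forall i j, Ck_on k U (fun x => Y x i j : R)) ->
  forall i j, Ck_on k U (fun x => u2_bracket (X x) (Y x) i j : R).
Proof.
move=> oU XC YC i j; rewrite (ord1 j).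
have XY a b c d : Ck_on k U (fun x => X x a ord0 * Y x b ord0
    - X x c ord0 * Y x d ord0).
  by apply: Ck_onD => //; [exact: Ck_onM|apply: Ck_onN => //; exact: Ck_onM].
elim/ord4_ind: i.
- apply: Ck_on_eq (XY (inord 1) (inord 2) (inord 2) (inord 1)) => // x _.
  by have [-> _ _ _] := u2_bracketE (X x) (Y x).
- apply: Ck_on_eq (XY (inord 2) (inord 0) (inord 0) (inord 2)) => // x _.
  by have [_ -> _ _] := u2_bracketE (X x) (Y x).
- apply: Ck_on_eq (XY (inord 0) (inord 1) (inord 1) (inord 0)) => // x _.
  by have [_ _ -> _] := u2_bracketE (X x) (Y x).
- apply: Ck_on_eq (Ck_on_cst _ _ _ _ 0) => // x _.
  by have [_ _ _ ->] := u2_bracketE (X x) (Y x).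
Qed.

(** For fixed vectors X and Y, both conditions are polynomial equations in [M]; the set is the
    intersection of their zero sets over all X, Y. *)
Lemma closed_u2_complex_structures : closed (@u2_complex_structures R).
Proof.
pose N (X Y : 'cV[R]_4) (M : 'M[R]_4) := u2_bracket (M *m X) (M *m Y)
  - u2_bracket X Y - M *m u2_bracket (M *m X) Y - M *m u2_bracket X (M *m Y).
(* [Ck_on 0 setT] is continuity, so the rules for [Ck_on] serve here as continuity rules. *)
have zero_closed (f : 'M[R]_4 -> 'cV[R]_4) :
    (forall i j, Ck_on 0 setT (fun M => f M i j : R)) -> closed [set M | f M = 0].
  move=> fC; rewrite (_ : mkset _ = f @^-1` [set 0])//.
  apply: closed_comp; last first.
    exact/accessible_closed_set1/hausdorff_accessible/norm_hausdorff.
  by move=> M _; apply: (Ck_on_mx _ _ _ 0 setT f _ fC) => //; exact: openT.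
have -> : @u2_complex_structures R =
    (\bigcap_(X in [set: 'cV[R]_4]) [set M | M *m (M *m X) + X = 0]) `&`
    \bigcap_(XY in [set: 'cV[R]_4 * 'cV[R]_4]) [set M | N XY.1 XY.2 M = 0].
  apply/seteqP; split=> [M [JJ NJ]|M [JJ NJ]].
    by split=> [X _|[X Y] _]; [rewrite /= JJ addNr|exact: NJ].
  split=> [X|X Y]; last exact: (NJ (X, Y)).
  by apply/eqP; rewrite -addr_eq0; apply/eqP; exact: JJ.
have idC i j : Ck_on 0 setT (fun M : 'M[R]_4 => M i j : R).
  exact: Ck_on_coord.
have cC (A : 'cV[R]_4) i j : Ck_on 0 setT (fun M : 'M[R]_4 => A i j : R).
  exact: Ck_on_cst.
have oT := @openT 'M[R]_4.
apply: closedI; apply: closed_bigI => X _; apply: zero_closed.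
  move=> i j; rewrite (_ : (fun M => _) = fun M => (M *m (M *m X) - (- X)) i j).
    apply: Ck_on_submx => //.
    by do 2![apply: Ck_on_mulmx => //].
  by apply/funext => M; rewrite opprK.
have mC (A : 'cV[R]_4) : forall i j, Ck_on 0 setT (fun M : 'M[R]_4 => (M *m A) i j : R).
  by apply: Ck_on_mulmx => //; exact: cC.
apply: Ck_on_submx => //; [apply: Ck_on_submx => //; [apply: Ck_on_submx => //|]|].
- by apply: Ck_on_u2_bracket => //; exact: mC.
- apply: Ck_on_mulmx => //.
  by apply: Ck_on_u2_bracket => //; exact: mC.
- apply: Ck_on_mulmx => //.
  by apply: Ck_on_u2_bracket => //; exact: mC.
Qed.

(** * Parametrization of the graphs by the last column *)

Lemma Ck_on_acs_entry (V : normedModType R) k (U : set V)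
    (b0 b1 b2 c s : V -> R) (e : R) i j : open U ->
  Ck_on k U b0 -> Ck_on k U b1 -> Ck_on k U b2 -> Ck_on k U c -> Ck_on k U s ->
  (i < 4)%N -> (j < 4)%N ->
  Ck_on k U (fun x => acs_entry e (b0 x) (b1 x) (b2 x) (c x) (s x) i j).
Proof.
move=> oU b0C b1C b2C cC sC.
case: i => [|[|[|[|//]]]] _; case: j => [|[|[|[|//]]]] _; rewrite /acs_entry //=;
  do ?[assumption | apply: (Ck_onD _ _ _ _ _ _ oU) | apply: (Ck_onN _ _ _ _ _ oU)
    | apply: (Ck_onM _ _ _ _ _ oU) | exact: Ck_on_cst].
Qed.

Lemma Ck_on_acs (V : normedModType R) k (U : set V) (w : V -> 'cV[R]_4) e i j :
  open U -> (forall l, Ck_on k U (fun x => w x l ord0 : R)) ->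
  (forall x, U x -> sqnorm3 (w x) != 0) ->
  Ck_on k U (fun x => acs e (w x) i j : R).
Proof.
move=> oU wC w0.
rewrite (_ : (fun x => _) = fun x => acs_entry e (w x (inord 0) ord0)
    (w x (inord 1) ord0) (w x (inord 2) ord0) (w x (inord 3) ord0)
    (Num.sqrt (sqnorm3 (w x)))^-1 i j); last by apply/funext => x; rewrite mxE.
apply: Ck_on_acs_entry => //; apply: Ck_on_rsqrt => //.
  by move=> x Ux; rewrite lt_def w0//= sqnorm3_ge0.
by rewrite /sqnorm3; apply: Ck_onD => //; [apply: Ck_onD => //|]; apply: Ck_onM.
Qed.

Definition acs_component (e : R) : set 'M[R]_4 :=
  [set M | sqnorm3 (col (inord 3) M) != 0 /\ M = acs e (col (inord 3) M)].

(** The pair is (c, b), with c in R and b in R^3, whereas the column lists b first. *)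
Definition last_col_of (p : R^o * 'rV[R]_3) : 'cV[R]_4 :=
  \col_i (if (i < 3)%N then p.2 ord0 (inord i) else p.1).

Definition last_col_split (M : 'M[R]_4) : R^o * 'rV[R]_3 :=
  (M (inord 3) (inord 3), \row_j M (inord j) (inord 3)).

Lemma last_col_ofE p : [/\ last_col_of p (inord 0) ord0 = p.2 ord0 (inord 0),
  last_col_of p (inord 1) ord0 = p.2 ord0 (inord 1),
  last_col_of p (inord 2) ord0 = p.2 ord0 (inord 2) &
  last_col_of p (inord 3) ord0 = p.1].
Proof. by split; rewrite mxE !inordK. Qed.

Lemma sqnorm3_eq0 (w : 'cV[R]_4) : (sqnorm3 w == 0) =
  [&& w (inord 0) ord0 == 0, w (inord 1) ord0 == 0 & w (inord 2) ord0 == 0].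
Proof.
by rewrite /sqnorm3 !paddr_eq0 ?addr_ge0 ?sqr_ge0// !sqrf_eq0 andbA.
Qed.

Lemma sqnorm3_last_col_of p : (sqnorm3 (last_col_of p) == 0) = (p.2 == 0).
Proof.
rewrite sqnorm3_eq0; have [-> -> -> _] := last_col_ofE p.
apply/and3P/eqP => [[/eqP p0 /eqP p1 /eqP p2]|->]; last by rewrite !mxE.
apply/rowP => i; rewrite -(inord_val i) mxE.
by case: i => -[|[|[|]]].
Qed.

Lemma last_col_splitK M : last_col_of (last_col_split M) = col (inord 3) M.
Proof.
have [E0 E1 E2 E3] := last_col_ofE (last_col_split M).
by apply/colP; apply: ord4_ind; rewrite ?(E0, E1, E2, E3) [RHS]mxE ?mxE ?inordK.
Qed.

Lemma last_col_ofK e p : last_col_split (acs e (last_col_of p)) = p.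
Proof.
have H i : acs e (last_col_of p) i (inord 3) = last_col_of p i ord0.
  by rewrite -[in RHS](acs_col e (last_col_of p)) [RHS]mxE.
rewrite /last_col_split; case: p H => c v H; congr (_, _).
  by rewrite H; have [_ _ _ ->] := last_col_ofE (c, v).
apply/rowP => i; rewrite mxE H mxE inordK ?ltn_ord ?inord_val//.
exact: leq_trans (ltn_ord i) _.
Qed.

Lemma open_snd_neq0 : open [set p : R^o * 'rV[R]_3 | p.2 != 0].
Proof.
rewrite (_ : mkset _ = snd @^-1` (~` [set 0])).
  apply: open_comp; first by move=> p _; exact: cvg_snd.
  exact/closed_openC/accessible_closed_set1/hausdorff_accessible/norm_hausdorff.
by apply/seteqP; split=> p /= /eqP.
Qed.

Lemma Ck_on_acs_last_col_of k e :
  Ck_on k [set p | p.2 != 0] (fun p => acs e (last_col_of p)).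
Proof.
have oU := open_snd_neq0.
apply: Ck_on_mx => // i j; apply: Ck_on_acs => //; last first.
  by move=> p /=; rewrite sqnorm3_last_col_of.
have c2 (l : 'I_3) :
    Ck_on k [set p : R^o * 'rV[R]_3 | p.2 != 0] (fun p => p.2 ord0 l : R).
  apply: Ck_on_islinear => [a p q|p]; first by rewrite !mxE.
  by apply: (@continuous_comp _ _ _ snd (fun v : 'rV[R]_3 => v ord0 l));
    [exact: cvg_snd|exact: coord_continuous].
apply: ord4_ind.
- apply: Ck_on_eq (c2 (inord 0)) => // p _.
  by have [-> _ _ _] := last_col_ofE p.
- apply: Ck_on_eq (c2 (inord 1)) => // p _.
  by have [_ -> _ _] := last_col_ofE p.
- apply: Ck_on_eq (c2 (inord 2)) => // p _.
  by have [_ _ -> _] := last_col_ofE p.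
- have : Ck_on k [set p : R^o * 'rV[R]_3 | p.2 != 0] (fun p => p.1 : R).
    by apply: Ck_on_islinear => [//|p]; exact: cvg_fst.
  apply: Ck_on_eq => // p _.
  by have [_ _ _ ->] := last_col_ofE p.
Qed.

(** Reading off the last column is linear on all of R^16, and its inverse, the graph map, is smooth
    on the open set b <> 0. *)
Lemma acs_component_diffeo e : diffeo_between (acs_component e)
  ([set: R^o] `*` [set v : 'rV[R]_3 | v != 0])
  last_col_split (fun p => acs e (last_col_of p)).
Proof.
split.
- move=> M _; exists setT, last_col_split; split=> //; first exact: openT.
  move=> k; apply: Ck_on_pair; [exact: openT|exact: Ck_on_coord|].
  apply: Ck_on_mx => [|i j]; first exact: openT.
  rewrite (_ : (fun M => _) = fun M : 'M[R]_4 => M (inord j) (inord 3)).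
    exact: Ck_on_coord.
  by apply/funext => N; rewrite mxE.
- move=> p [_ p0]; exists [set p | p.2 != 0], (fun p => acs e (last_col_of p)).
  split=> //; last by move=> k; exact: Ck_on_acs_last_col_of.
  exact: open_snd_neq0.
- move=> M [w0 _]; split=> //=.
  by rewrite -[X in X != 0]/(last_col_split M).2 -sqnorm3_last_col_of last_col_splitK.
- move=> p [_ /= p0]; split; first by rewrite /= acs_col sqnorm3_last_col_of.
  by rewrite /= acs_col.
- split=> [M /set_mem[_ ME]|p _]; last exact: last_col_ofK.
  by rewrite last_col_splitK -ME.
Qed.

Lemma acs_component_connected e : connected (acs_component e).
Proof.
have [_ _ fAB gBA [fgK _]] := acs_component_diffeo e.
have -> : acs_component e = (fun p => acs e (last_col_of p)) @`
    ([set: R^o] `*` [set v : 'rV[R]_3 | v != 0]).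
  apply/seteqP; split=> [M eM|_ [p p0 <-]]; last exact: gBA.
  by exists (last_col_split M); [exact: fAB|exact/fgK/mem_set].
apply: connected_continuous_connected; first exact: connected_punctured.
apply: continuous_in_subspaceT => p /set_mem[_ p0].
exact: (Ck_on_acs_last_col_of 0 e).
Qed.

(** * Separation of the two graphs by sign, and the connected components *)

Definition chirality (M : 'M[R]_4) : R :=
  M (inord 0) (inord 3) * (M (inord 2) (inord 1) - M (inord 1) (inord 2))
  + M (inord 1) (inord 3) * (M (inord 0) (inord 2) - M (inord 2) (inord 0))
  + M (inord 2) (inord 3) * (M (inord 1) (inord 0) - M (inord 0) (inord 1)).

(** [chirality] is twice the number t from the proof of [acs_entries], and t = e |b|. As a
    polynomial on all of R^16 it also cuts out open sets for the charts. *)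
Lemma chirality_acs e w : sqnorm3 w != 0 ->
  chirality (acs e w) = 2 * e * Num.sqrt (sqnorm3 w).
Proof.
move=> w0; rewrite /chirality !acsE// /acs_entry /=.
have : (Num.sqrt (sqnorm3 w)) ^+ 2 = sqnorm3 w by rewrite sqr_sqrtr ?sqnorm3_ge0.
have r0 : Num.sqrt (sqnorm3 w) != 0.
  by rewrite sqrtr_eq0 -ltNge lt_def w0 sqnorm3_ge0.
rewrite [in RHS]/sqnorm3; move: r0; set r := Num.sqrt _ => r0 rE.
(* Isolates a factor r^2 to be replaced by the polynomial |b|^2. *)
transitivity (2 * e / r * r ^+ 2); last by field.
by rewrite rE; ring.
Qed.

Lemma Ck_on_chirality (V : normedModType R) k (U : set V) (F : V -> 'M[R]_4) :
  open U -> (forall i j, Ck_on k U (fun x => F x i j : R)) ->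
  Ck_on k U (fun x => chirality (F x)).
Proof.
move=> oU FC; have D i j a b c d : Ck_on k U (fun x =>
    F x (inord i) (inord j) * (F x (inord a) (inord b) - F x (inord c) (inord d)) : R).
  by apply: Ck_onM => //; apply: Ck_onD => //; exact: Ck_onN.
by apply: Ck_onD => //; first apply: Ck_onD.
Qed.

Lemma sqr_eq1_sign (e : R) : e ^+ 2 = 1 -> e = 1 \/ e = -1.
Proof. by move/eqP; rewrite sqrf_eq1 => /orP[/eqP ->|/eqP ->]; [left|right]. Qed.

Lemma acs_component_chirality e M : acs_component e M ->
  0 < Num.sqrt (sqnorm3 (col (inord 3) M)) /\
  chirality M = 2 * e * Num.sqrt (sqnorm3 (col (inord 3) M)).
Proof.
case=> w0 ME; split; first by rewrite sqrtr_gt0 lt_def w0 sqnorm3_ge0.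
by rewrite {1}ME chirality_acs.
Qed.

Lemma u2_complex_structuresE :
  @u2_complex_structures R = acs_component 1 `|` acs_component (-1).
Proof.
apply/seteqP; split=> [M /u2_complex_structureP[w0 [e e1 ME]]|M].
  by case: (sqr_eq1_sign e e1) ME => -> ME; [left|right]; split.
by case=> -[w0 ME]; apply/u2_complex_structureP; split=> //; [exists 1|exists (-1)];
  rewrite ?sqrrN ?expr1n.
Qed.

(** The graph is connected, which gives one inclusion. Conversely, [chirality] maps a connected set
    of complex structures onto an interval avoiding 0, so its sign is constant and the set stays in
    one graph. *)
Lemma connected_component_acs e M : e = 1 \/ e = -1 -> acs_component e M ->
  connected_component (@u2_complex_structures R) M = acs_component e.
Proof.
move=> e1 eM; apply/seteqP; split; last first.
  apply: connected_component_max => //; last exact: acs_component_connected.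
  by rewrite u2_complex_structuresE; case: e1 => ->; [left|right].
move=> N [C [CM CX Cc] CN].
have : is_interval (chirality @` C).
  apply/connected_intervalP/connected_continuous_connected => //.
  apply: continuous_subspaceT => K; apply: (Ck_on_chirality _ 0 setT id openT) => //.
  by move=> i j; exact: (Ck_on_coord 4 4 0).
have nz K : C K -> chirality K != 0.
  move=> /CX; rewrite u2_complex_structuresE => -[] /acs_component_chirality[s0 ->].
    by rewrite mulr1 mulf_neq0// gt_eqF.
  by rewrite mulrN1 mulNr oppr_eq0 mulf_neq0// gt_eqF.
have [s0 sM] := acs_component_chirality e M eM.
move=> iC; have sgn x y : (chirality @` C) x -> (chirality @` C) y ->
    x <= 0 -> 0 <= y -> False.
  move=> Cx Cy x0 y0; have [|K CK K0] := iC x y Cx Cy 0; first by rewrite x0.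
  by move: (nz K CK); rewrite K0 eqxx.
have := CX N CN; rewrite u2_complex_structuresE => NE.
have CN' : (chirality @` C) (chirality N) by exists N.
have CM' : (chirality @` C) (chirality M) by exists M.
case: e1 eM sM => -> eM sM; case: NE => // NE; exfalso;
  have [t0 tN] := acs_component_chirality _ _ NE.
- by apply: (sgn _ _ CN' CM'); rewrite ?sM ?tN; nra.
- by apply: (sgn _ _ CM' CN'); rewrite ?sM ?tN; nra.
Qed.

Lemma acs_component_acs e (w : 'cV[R]_4) :
  sqnorm3 w != 0 -> acs_component e (acs e w).
Proof. by move=> w0; split; rewrite acs_col. Qed.

Lemma acs_component_neq0 e : acs_component e !=set0.
Proof.
exists (acs e (const_mx 1)); apply: acs_component_acs.
by rewrite sqnorm3_eq0 !mxE oner_eq0.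
Qed.

Lemma u2_connected_components :
  [set connected_component u2_complex_structures J | J in @u2_complex_structures R]
  = [set acs_component 1; acs_component (-1)].
Proof.
apply/seteqP; split=> [_ [J + <-]|C].
  rewrite u2_complex_structuresE => -[] eJ; rewrite -u2_complex_structuresE.
    by left; apply: connected_component_acs => //; left.
  by right; apply: connected_component_acs => //; right.
case=> ->; [have [J eJ] := acs_component_neq0 1|have [J eJ] := acs_component_neq0 (-1)];
  exists J; rewrite ?u2_complex_structuresE; do ?[by left|by right];
  rewrite -u2_complex_structuresE; apply: connected_component_acs => //;
  by [left|right].
Qed.

Lemma acs_component_neq : acs_component 1 <> acs_component (-1).
Proof.
move=> E; have [J eJ] := acs_component_neq0 1.
have [s0 sJ] := acs_component_chirality _ _ eJ.
by rewrite E in eJ; have [t0 tJ] := acs_component_chirality _ _ eJ; clear E; nra.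
Qed.

End Components.

(** * Slice charts *)

Section Charts.
Context {R : realType}.

Lemma flat_ord_subproof (i j : 'I_4) : ((3 - j) * 4 + i < 4 * 4)%N.
Proof. by case: i j => -[|[|[|[|//]]]] ? [[|[|[|[|//]]]]] ?. Qed.

Definition flat_ord (i j : 'I_4) : 'I_(4 * 4) := Ordinal (flat_ord_subproof i j).

(* The last column of [M] comes first, so that the slice [coord_slice 16 4]
   corresponds to the matrices whose first three columns vanish. *)
Definition flat (M : 'M[R]_4) : 'rV[R]_(4 * 4) :=
  \row_k M (inord (k %% 4)) (inord (3 - k %/ 4)).

Definition unflat (y : 'rV[R]_(4 * 4)) : 'M[R]_4 :=
  \matrix_(i, j) y ord0 (flat_ord i j).

Lemma flatK : cancel flat unflat.
Proof.
move=> M; apply/matrixP => i j; rewrite !mxE /=.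
rewrite modnMDl divnMDl// (modn_small (ltn_ord i)) divn_small ?addn0//.
by rewrite (subKn (leq_ord j)) !inord_val.
Qed.

Lemma unflatK : cancel unflat flat.
Proof.
move=> y; apply/rowP => k; rewrite !mxE; congr (y _ _); apply: val_inj => /=.
have k4 : (k %/ 4 < 4)%N by rewrite ltn_divLR.
by rewrite !inordK ?ltn_pmod// ?ltnS ?leq_subr// subKn -1?ltnS// -divn_eq.
Qed.

Definition last_col_mx (w : 'cV[R]_4) : 'M[R]_4 :=
  \matrix_(i, j) (if j == inord 3 then w i ord0 else 0).

Lemma last_col_mx_col w : col (inord 3) (last_col_mx w) = w.
Proof. by apply/colP => i; rewrite !mxE eqxx. Qed.

(** Subtracting [acs e w], where w is the last column, sends the graph to 0 but erases w; adding
    [last_col_mx w] restores it. The last column is thus preserved, so the inverse can use the same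
    w. *)
Definition shear (e : R) (M : 'M[R]_4) : 'M[R]_4 :=
  M - acs e (col (inord 3) M) + last_col_mx (col (inord 3) M).

Definition unshear (e : R) (M : 'M[R]_4) : 'M[R]_4 :=
  M + acs e (col (inord 3) M) - last_col_mx (col (inord 3) M).

Lemma col3_shear e M : col (inord 3) (shear e M) = col (inord 3) M.
Proof.
rewrite /shear linearD linearB /= acs_col last_col_mx_col; exact: subrK.
Qed.

Lemma col3_unshear e M : col (inord 3) (unshear e M) = col (inord 3) M.
Proof.
rewrite /unshear linearB linearD /= acs_col last_col_mx_col; exact: addrK.
Qed.

Lemma shearK e : cancel (shear e) (unshear e).
Proof.
by move=> M; rewrite /unshear col3_shear /shear addrAC addrK subrK.
Qed.

Lemma unshearK e : cancel (unshear e) (shear e).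
Proof.
by move=> M; rewrite /shear col3_unshear /unshear addrAC subrK addrK.
Qed.

Lemma shear_acs_componentP e M : sqnorm3 (col (inord 3) M) != 0 ->
  acs_component e M <-> shear e M = last_col_mx (col (inord 3) M).
Proof.
move=> w0; split=> [[_ ME]|]; first by rewrite /shear -ME subrr add0r.
by rewrite -[RHS]add0r => /addIr /subr0_eq ME; split.
Qed.

Lemma Ck_on_last_col_mx (V : normedModType R) k (U : set V) (w : V -> 'cV[R]_4) i j :
  (forall l, Ck_on k U (fun x => w x l ord0 : R)) ->
  Ck_on k U (fun x => last_col_mx (w x) i j : R).
Proof.
move=> wC; rewrite (_ : (fun x => _) =
  fun x => if j == inord 3 then w x i ord0 else 0); last first.
  by apply/funext => x; rewrite mxE.
by case: eqP => _ //; exact: Ck_on_cst.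
Qed.

Lemma Ck_on_col (V : normedModType R) k (U : set V) m n
    (F : V -> 'M[R]_(m, n)) j :
  (forall i j, Ck_on k U (fun x => F x i j : R)) ->
  forall l, Ck_on k U (fun x => col j (F x) l ord0 : R).
Proof.
move=> FC l; rewrite (_ : (fun x => _) = fun x => F x l j); first exact: FC.
by apply/funext => x; rewrite mxE.
Qed.

Lemma Ck_on_shear (V : normedModType R) k (U : set V) (F : V -> 'M[R]_4) e :
  open U -> (forall i j, Ck_on k U (fun x => F x i j : R)) ->
  (forall x, U x -> sqnorm3 (col (inord 3) (F x)) != 0) ->
  forall i j, Ck_on k U (fun x => shear e (F x) i j : R).
Proof.
move=> oU FC F0 i j; have wC := Ck_on_col _ _ _ _ _ _ (inord 3) FC.
rewrite (_ : (fun x => _) = fun x => F x i j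
    + - acs e (col (inord 3) (F x)) i j + last_col_mx (col (inord 3) (F x)) i j).
  apply: Ck_onD => //; last exact: Ck_on_last_col_mx.
  by apply: Ck_onD => //; apply: Ck_onN => //; exact: Ck_on_acs.
by apply/funext => x; rewrite [LHS]mxE [X in X + _]mxE [X in _ + X + _]mxE.
Qed.

Lemma Ck_on_unshear (V : normedModType R) k (U : set V) (F : V -> 'M[R]_4) e :
  open U -> (forall i j, Ck_on k U (fun x => F x i j : R)) ->
  (forall x, U x -> sqnorm3 (col (inord 3) (F x)) != 0) ->
  forall i j, Ck_on k U (fun x => unshear e (F x) i j : R).
Proof.
move=> oU FC F0 i j; have wC := Ck_on_col _ _ _ _ _ _ (inord 3) FC.
rewrite (_ : (fun x => _) = fun x => F x i j
    + acs e (col (inord 3) (F x)) i j + - last_col_mx (col (inord 3) (F x)) i j).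
  apply: Ck_onD => //; last by apply: Ck_onN => //; exact: Ck_on_last_col_mx.
  by apply: Ck_onD => //; exact: Ck_on_acs.
by apply/funext => x; rewrite [LHS]mxE [X in X + _]mxE [X in _ + X]mxE.
Qed.

Lemma open_sqnorm3_neq0 (V : normedModType R) (F : V -> 'M[R]_4) :
  (forall i j, Ck_on 0 setT (fun x => F x i j : R)) ->
  open [set x | sqnorm3 (col (inord 3) (F x)) != 0].
Proof.
move=> FC; have oT := @openT V.
have D i : Ck_on 0 setT
    (fun x => F x (inord i) (inord 3) * F x (inord i) (inord 3) : R).
  exact: Ck_onM.
have DC : Ck_on 0 setT (fun x => sqnorm3 (col (inord 3) (F x))).
  have D01 := Ck_onD _ _ _ _ _ _ oT (D 0%N) (D 1%N).
  apply: Ck_on_eq oT _ (Ck_onD _ _ _ _ _ _ oT D01 (D 2%N)).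
  by move=> x _; rewrite /sqnorm3 !mxE !expr2.
have o0 : open [set r : R | r != 0] by exact: open_neq.
by have := open_preimage_on V setT _ _ oT DC o0; rewrite setTI.
Qed.

(** Around a point of the graph of sign e, the chart is the shear followed by flattening; it sends
    that graph into the matrices with only the last column nonzero. *)
Lemma smooth_submanifold_u2 : smooth_submanifold 4 (@u2_complex_structures R).
Proof.
split=> // p; rewrite u2_complex_structuresE => Xp.
have {Xp} [e e1 ep] : exists2 e : R, e = 1 \/ e = -1 & acs_component e p.
  by case: Xp => ?; [exists 1|exists (-1)]; auto.
pose phi := flat \o shear e; pose psi := unshear e \o unflat.
(* The two maps are inverse to each other everywhere; smoothness holds only where b <> 0. *)
have phiK : cancel phi psi by move=> M; rewrite /psi /phi /= flatK shearK.
have psiK : cancel psi phi by move=> M; rewrite /psi /phi /= unshearK unflatK.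
have idC k i j (A : set 'M[R]_4) : Ck_on k A (fun M => M i j : R) by exact: Ck_on_coord.
have unC k i j (A : set 'rV[R]_(4 * 4)) : Ck_on k A (fun y => unflat y i j : R).
  rewrite (_ : (fun y => _) = fun y : 'rV[R]_(4 * 4) => y ord0 (flat_ord i j)).
    exact: Ck_on_coord.
  by apply/funext => y; rewrite mxE.
pose U0 := [set M : 'M[R]_4 | sqnorm3 (col (inord 3) M) != 0].
pose W0 := [set y | sqnorm3 (col (inord 3) (unflat y)) != 0].
have oU0 : open U0 by apply: (open_sqnorm3_neq0 _ id) => i j; exact: idC.
have oW0 : open W0 by apply: open_sqnorm3_neq0.
have phiC k : Ck_on k U0 phi.
  apply: Ck_on_mx => // i j; rewrite (_ : (fun M => _) =
    fun M => shear e M (inord (j %% 4)) (inord (3 - j %/ 4))).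
    by apply: Ck_on_shear.
  by apply/funext => M; rewrite mxE.
have psiE k i j : Ck_on k W0 (fun y => psi y i j : R).
  by apply: (Ck_on_unshear _ _ _ unflat).
have psiC k : Ck_on k W0 psi by exact: Ck_on_mx.
pose P := [set x : R | 0 < x].
have oP : open P by exact: open_gt.
(* The sign condition removes the other graph, so that inside [U] the complex structures are exactly
   the graph of sign e. *)
pose U := U0 `&` (fun M => e * chirality M) @^-1` P.
pose W := W0 `&` (fun y => e * chirality (psi y)) @^-1` P.
have UW M : U M -> W (phi M).
  by move=> [M0 M1]; split; rewrite /= ?phiK// /W0/= /phi/= flatK col3_shear.
have WU y : W y -> U (psi y).
  by move=> [y0 y1]; split; rewrite // /U0/= col3_unshear.
exists U, W, phi, psi; split.
- apply: open_preimage_on => // M U0M.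
  apply: (Ck_onM _ 0 U0) => //; first exact: Ck_on_cst.
  by apply: (Ck_on_chirality _ _ _ id) => // i j; exact: idC.
- have [s0 sp] := acs_component_chirality _ _ ep.
  by split; [exact: ep.1|rewrite /P /= sp; case: e1 => ->; nra].
- apply: open_preimage_on => // y W0y.
  apply: (Ck_onM _ 0 W0) => //; first exact: Ck_on_cst.
  exact: Ck_on_chirality.
- split; [| |exact: UW|exact: WU|by split=> z _; [exact: phiK|exact: psiK]].
  + by apply: (Ck_on_smooth_on _ _ _ U0) => // M [].
  + by apply: (Ck_on_smooth_on _ _ _ W0) => // y [].
apply/seteqP; split=> [_ [M [UM XM] <-]|y [Wy y0]].
  split; first exact: UW.
  have eM : acs_component e M.
    move: UM => [_]; rewrite /P /=.
    case: e1 XM => -> -[] // /acs_component_chirality[t0 ->]; nra.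
  move=> k k4; rewrite mxE; have [+ _] := shear_acs_componentP e M UM.1.
  move=> /(_ eM) ->; rewrite mxE -val_eqE /= !inordK ?ltnS ?leq_subr//.
  (* For k >= 4 the column index 3 - k / 4 is less than 3, so the entry lies outside the last
     column. *)
  have : (0 < k %/ 4)%N by rewrite divn_gt0.
  by case: (k %/ 4)%N => // n _; rewrite ifF//; apply/eqP; lia.
exists (psi y); last exact: psiK.
split; first exact: WU.
have [U0y _] := WU y Wy.
suff : acs_component e (psi y).
  by case: e1 => ->; [left|right].
apply/(shear_acs_componentP e) => //; rewrite /psi /= unshearK col3_unshear.
apply/matrixP => i j; rewrite [RHS]mxE; case: eqP => [->|j3]; first by rewrite [RHS]mxE.
(* For j < 3 the position 4 (3 - j) + i is at least 4, where [y] vanishes. *)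
rewrite mxE y0//=; move: j3 => /eqP; rewrite -val_eqE /= inordK//.
by have := ltn_ord j; lia.
Qed.

End Charts.

Theorem corollary2 (R : realType) :
  let X : set 'M[R]_4 := u2_complex_structures in
  let components : set (set 'M[R]_4) :=
    [set connected_component X J | J in X] in
  [/\ closed X,
      smooth_submanifold 4 X,
      (components #= `I_2)%card &
      forall C, components C ->
        diffeomorphic C ([set: R^o] `*` [set v : 'rV[R]_3 | v != 0])].
Proof.
move=> X components.
have cE : components = _ := u2_connected_components.
split; [exact: closed_u2_complex_structures|exact: smooth_submanifold_u2| |].
  by rewrite cE; apply: card_set2_II; exact: acs_component_neq.
by move=> C; rewrite cE => -[] ->; do 2!eexists; exact: acs_component_diffeo.
Qed.
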